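(* Let $\Gamma$ be a graph. Suppose there exist a family $\mathcal{F}$ of subgraphs of $\Gamma$ and a subset $E\subseteq E(\Gamma)$ such that: (i) $\Gamma$ is the union of the subgraphs in $\mathcal{F}$; (ii) each $\Sigma\in\mathcal{F}$ is a generalized closed ladder, each edge of $E(\Sigma)\cap E$ is a rung of $\Sigma$, and $|E(\Sigma)\cap E|\ge2$ whenever $\Sigma$ does not admit a nowhere-zero $3$-flow; (iii) each edge in $E$ is a rung of at least two distinct subgraphs in $\mathcal{F}$, and each edge in $E(\Gamma)\setminus E$ is contained in a unique subgraph in $\mathcal{F}$. Then $\Gamma$ admits a nowhere-zero $3$-flow.
   Context: Graphs are finite, undirected and loopless, with parallel edges allowed; the union of graphs takes unions of vertex sets and of edge sets. A $k$-flow in a graph is a pair $(D,\varphi)$ where $D$ is an orientation and $\varphi$ assigns an integer to each arc with $|\varphi(e)|<k$ and with flow conservation at every vertex; it is nowhere-zero if $\varphi$ never vanishes. For $n\ge2$, the circular ladder $CL_n$ is the Cayley graph of $\mathbb{Z}_n\times\mathbb{Z}_2$ with connection set $\{(1,0),(-1,0),(0,1)\}$ (for $n=2$ with parallel edges); its rungs are the edges $\{(i,0),(i,1)\}$ and its other edges are rail edges. The Möbius ladder $M_n$ ($n\ge2$) is the Cayley graph of $\mathbb{Z}_{2n}$ with connection set $\{1,-1,n\}$; its rungs are the edges $\{i,i+n\}$ and its other edges are rail edges. A generalized circular (resp. Möbius) ladder with $n\ge2$ rungs is obtained from $CL_n$ (resp. $M_n$) by replacing each rail edge by a path of length at least one (rungs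 stay rungs). By convention, graphs obtained from a generalized circular ladder with two rungs by deleting one or both rungs are generalized circular ladders with one rung or zero rungs, and graphs obtained from a generalized Möbius ladder with two rungs by deleting one or both rungs (a cycle with one chord, or a cycle) are generalized Möbius ladders with one rung (the chord) or zero rungs. A generalized closed ladder is a generalized circular or Möbius ladder. *)

(* Defs.v *)
From HB Require Import structures.
From mathcomp Require Import all_boot all_order all_algebra.
Set Implicit Arguments. Unset Strict Implicit. Unset Printing Implicit Defensive.
Import Order.TTheory GRing.Theory Num.Theory.

(* The pair (end1 e, end2 e) only presents the unordered pair [ends e]; it is
   not an orientation: flows and isomorphisms refer to [ends] alone. *)
Record mgraph := MGraph {
  vert : finType;
  edge : finType;
  end1 : edge -> vert;
  end2 : edge -> vert;
  loopless : forall e, end1 e != end2 e }.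

Arguments end1 {m} e.
Arguments end2 {m} e.

Definition ends (G : mgraph) (e : edge G) : {set vert G} :=
  [set end1 e; end2 e].

(* An orientation maps each edge to the pair (tail, head). *)
Definition orientation (G : mgraph) (D : edge G -> vert G * vert G) : Prop :=
  forall e, [set (D e).1; (D e).2] = ends e.

Definition is_flow (G : mgraph) (k : nat)
    (D : edge G -> vert G * vert G) (phi : edge G -> int) : Prop :=
  [/\ orientation D,
      forall e, (`|phi e| < k%:Z)%R
    & forall v, (\sum_(e | (D e).1 == v) phi e =
                 \sum_(e | (D e).2 == v) phi e)%R].

Definition has_nowhere_zero_flow (k : nat) (G : mgraph) : Prop :=
  exists (D : edge G -> vert G * vert G) (phi : edge G -> int),
    is_flow k D phi /\ forall e, phi e <> 0%R.

Definition is_subgraph (G : mgraph) (S : {set vert G} * {set edge G}) : bool :=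
  [forall e in S.2, ends e \subset S.1].

Record subgraph (G : mgraph) := Subgraph {
  sub_sets :> {set vert G} * {set edge G};
  sub_setsP : is_subgraph sub_sets }.

HB.instance Definition _ (G : mgraph) := [isSub for @sub_sets G].
HB.instance Definition _ (G : mgraph) := [Finite of subgraph G by <:].

Definition sverts (G : mgraph) (S : subgraph G) : {set vert G} := S.1.
Definition sedges (G : mgraph) (S : subgraph G) : {set edge G} := S.2.

Section SubgraphAsGraph.
Variables (G : mgraph) (S : subgraph G).

Lemma sub_ends (e : {e : edge G | e \in sedges S}) :
  (end1 (val e) \in sverts S) && (end2 (val e) \in sverts S).
Proof.
have /subsetP h := forall_inP (sub_setsP S) _ (valP e).
by rewrite /sverts !h // !inE eqxx ?orbT.
Qed.

Lemma sub_end1 (e : {e : edge G | e \in sedges S}) :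
  end1 (val e) \in sverts S.
Proof. by case/andP: (sub_ends e). Qed.

Lemma sub_end2 (e : {e : edge G | e \in sedges S}) :
  end2 (val e) \in sverts S.
Proof. by case/andP: (sub_ends e). Qed.

Lemma sub_loopless (e : {e : edge G | e \in sedges S}) :
  exist (fun v => v \in sverts S) (end1 (val e)) (sub_end1 e) !=
  exist (fun v => v \in sverts S) (end2 (val e)) (sub_end2 e).
Proof. by rewrite -val_eqE /= loopless. Qed.

Definition graph_of_sub : mgraph := MGraph sub_loopless.

End SubgraphAsGraph.

Section Subdivision.
Variables (G : mgraph) (m : edge G -> nat).

Let svert : finType := (vert G + {e : edge G & 'I_(m e)})%type.
Let sedge : finType := {e : edge G & 'I_(m e).+1}.

(* The k-th vertex, 0 <= k <= (m e).+1, of the path replacing e. *)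
Definition path_vert (e : edge G) (k : nat) : svert :=
  if k is k'.+1 then
    if (insub k' : option 'I_(m e)) is Some j then inr (Tagged (fun e => 'I_(m e)) j)
    else inl (end2 e)
  else inl (end1 e).

Lemma subdiv_loopless (d : sedge) :
  path_vert (tag d) (tagged d) != path_vert (tag d) (tagged d).+1.
Proof.
case: d => e [[|k] /= lt_k]; first by case: insubP => //= _; exact: loopless.
rewrite insubT; case: insubP => //= j _ jE; apply/eqP => -[] /eqP.
by rewrite eq_Tagged /= -val_eqE /= jE ltn_eqF.
Qed.

(* Every edge e is replaced by a path of length (m e).+1. *)
Definition subdivide : mgraph := MGraph subdiv_loopless.

End Subdivision.

Section EdgeDeletion.
Variables (G : mgraph) (D : {set edge G}).

Lemma del_loopless (e : {e : edge G | e \notin D}) :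
  end1 (val e) != end2 (val e).
Proof. exact: loopless. Qed.

Definition delete_edges : mgraph := MGraph del_loopless.

End EdgeDeletion.

(* Graphs with distinguished rungs; the other edges are the rail edges.  The
   rungs are part of the data as the underlying graph need not determine them
   (e.g. in K_4 = M_2). *)
Record rgraph := RGraph { graph :> mgraph; rungs : {set edge graph} }.

Definition subdivide_rails (L : rgraph) (m : edge L -> nat) : rgraph :=
  @RGraph (subdivide m) [set d | tag d \in rungs L].

Definition delete_rungs (L : rgraph) (D : {set edge L}) : rgraph :=
  @RGraph (delete_edges D) [set e | val e \in rungs L].

Definition isomorphic (L L' : rgraph) : Prop :=
  exists (f : vert L -> vert L') (g : edge L -> edge L'),
    [/\ bijective f, bijective g,
        forall e, f @: ends e = ends (g e)
      & g @: rungs L = rungs L'].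

(* CL n and Mob n are meant for 2 <= n only, as 'Z_n is Z/2 for n < 2.
   Edges of CL n: inl (i, j) is the rail edge {(i, j), (i + 1, j)} and inr i
   the rung {(i, 0), (i, 1)}, with Z/2 written as bool.  For n = 2 this yields
   the parallel rail edges. *)
Section CircularLadder.
Variable n : nat.

Let cvert : finType := ('Z_n * bool)%type.
Let cedge : finType := ('Z_n * bool + 'Z_n)%type.

Definition CL_end1 (e : cedge) : cvert :=
  match e with inl (i, j) => (i, j) | inr i => (i, false) end.
Definition CL_end2 (e : cedge) : cvert :=
  match e with inl (i, j) => ((i + 1)%R, j) | inr i => (i, true) end.

Lemma CL_loopless (e : cedge) : CL_end1 e != CL_end2 e.
Proof.
case: e => [[i j]|i]; rewrite xpair_eqE ?eqxx //= andbT.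
by rewrite -subr_eq0 opprD addNKr oppr_eq0 oner_eq0.
Qed.

Definition CL : rgraph :=
  @RGraph (MGraph CL_loopless) [set e | if e is inr _ then true else false].

End CircularLadder.

(* Edges of Mob n: inl i is the rail edge {i, i + 1} (i in Z/2n) and inr i the
   rung {i, i + n} (0 <= i < n). *)
Section MobiusLadder.
Variable n : nat.

Let mvert : finType := 'Z_(n.*2).
Let medge : finType := ('Z_(n.*2) + 'I_n)%type.

Definition Mob_end1 (e : medge) : mvert :=
  match e with inl i => i | inr i => (i : nat)%:R%R end.
Definition Mob_end2 (e : medge) : mvert :=
  match e with inl i => (i + 1)%R | inr i => (i + n)%:R%R end.

Lemma Mob_loopless (e : medge) : Mob_end1 e != Mob_end2 e.
Proof.
case: e => i /=.
  by rewrite -subr_eq0 opprD addNKr oppr_eq0 oner_eq0.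
have n_gt0 : 0 < n by apply: leq_ltn_trans (ltn_ord i).
rewrite natrD -subr_eq0 opprD addNKr oppr_eq0 -val_eqE /=.
have n2_gt1 : 1 < n.*2 by case: (n) n_gt0.
rewrite val_Zp_nat // modn_small -?lt0n //.
by rewrite -addnn -[ltnLHS]addn0 ltn_add2l.
Qed.

Definition Mob : rgraph :=
  @RGraph (MGraph Mob_loopless) [set e | if e is inr _ then true else false].

End MobiusLadder.

Definition rail_subdivision (B L : rgraph) : Prop :=
  exists m : edge B -> nat,
    (forall e, e \in rungs B -> m e = 0) /\ isomorphic (subdivide_rails m) L.

(* L is a generalized ladder with n rungs, over the base ladders B. *)
Definition gen_ladder (B : nat -> rgraph) (n : nat) (L : rgraph) : Prop :=
  if 2 <= n then rail_subdivision (B n) L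
  else exists (L2 : rgraph) (D : {set edge L2}),
    [/\ rail_subdivision (B 2) L2, D \subset rungs L2, #|D| = 2 - n
      & isomorphic (delete_rungs D) L].

Definition gen_circular_ladder := gen_ladder CL.
Definition gen_mobius_ladder := gen_ladder Mob.

Definition gen_closed_ladder (L : rgraph) : Prop :=
  exists n, gen_circular_ladder n L \/ gen_mobius_ladder n L.

(* S is a generalized closed ladder whose set of rungs is R. *)
Definition is_closed_ladder_with (G : mgraph) (S : subgraph G)
    (R : {set edge G}) : Prop :=
  R \subset sedges S /\
  gen_closed_ladder (@RGraph (graph_of_sub S) [set e | val e \in R]).

(* Main.v *)
Require Import Defs.
From HB Require Import structures.
From mathcomp Require Import all_boot all_order all_algebra.
From mathcomp Require Import zify ring.
Set Implicit Arguments. Unset Strict Implicit. Unset Printing Implicit Defensive.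
Import Order.TTheory GRing.Theory Num.Theory.

(* Everything happens modulo 3. On a closed ladder let the rail values be +-1,
   opposite on the two sides of the ladder; a rung then carries the difference
   of two consecutive rail values, so it is zero or not according to whether the
   sign is kept or changed there. Given forbidden values [a] on the rungs, change
   the sign where [a = 0] and keep it elsewhere: going once around, the pattern
   closes up as soon as one rung has [a != 0], because that rung tolerates both
   keeping the sign and one of the two sign changes.

   The members of the family are then treated one after another, adding up the
   circulations, so that the sum vanishes on at most one of the edges met so
   far. If an untreated member has a nowhere-zero flow or meets an edge where the
   sum is nonzero, all its edges can be made nonzero. Otherwise the sum is zero
   on every untreated member, and one chooses a member through the defective
   edge (if any) and moves the defect to another of its edges in [E]; that edge
   has not been met before, so a further untreated member contains it. Hence no
   defect is left at the end, and the resulting nowhere-zero flow modulo 3 is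
   lifted to an integral one by augmenting paths. *)

Local Open Scope ring_scope.

(** * Net outflow over a ring, and arithmetic in the field of three elements *)

Definition inc (R : pzRingType) (G : mgraph) (o : edge G -> vert G * vert G)
    (e : edge G) (v : vert G) : R :=
  ((o e).1 == v)%:R - ((o e).2 == v)%:R.
Arguments inc R {G} o e v.

(** Outflow minus inflow: circulations are the [x] whose net is zero everywhere. Writing it with
    signed incidences makes it visibly additive in [x]. *)
Definition net (R : pzRingType) (G : mgraph) (o : edge G -> vert G * vert G)
    (x : edge G -> R) (v : vert G) : R :=
  \sum_e x e * inc R o e v.

Definition std_orient (G : mgraph) (e : edge G) : vert G * vert G :=
  (end1 e, end2 e).
Arguments std_orient G e : clear implicits.

Lemma std_orientP (G : mgraph) : orientation (std_orient G).
Proof. by []. Qed.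

Lemma netE (R : pzRingType) (G : mgraph) o (x : edge G -> R) v :
  net o x v = \sum_(e | (o e).1 == v) x e - \sum_(e | (o e).2 == v) x e.
Proof.
rewrite /net (big_mkcond (fun e => (o e).1 == v)).
rewrite (big_mkcond (fun e => (o e).2 == v)) -sumrB; apply: eq_bigr => e _.
by rewrite /inc mulrBr; do 2 case: eqP => _; rewrite ?mulr1 ?mulr0.
Qed.

Lemma sum_net (R : pzRingType) (G : mgraph) o (x : edge G -> R) :
  \sum_v net o x v = 0.
Proof.
rewrite /net exchange_big big1 // => e _.
rewrite -mulr_sumr /inc sumrB.
suff H (w : vert G) : \sum_(v : vert G) (w == v)%:R = 1 :> R by rewrite !H subrr mulr0.
rewrite (bigD1 w) //= eqxx big1 ?addr0 // => i.
by rewrite eq_sym => /negbTE ->.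
Qed.

Lemma sum_sub (R : nmodType) (T : finType) (P : pred T) (F : T -> R) :
  (forall i, ~~ P i -> F i = 0) -> \sum_i F i = \sum_(i : {i | P i}) F (val i).
Proof.
move=> F0; rewrite (bigID P) /= [X in _ + X]big1 ?addr0 => [|i /F0 //].
exact: (big_sub P).
Qed.

Lemma F3_cases (x : 'F_3) : [\/ x = 0, x = 1 | x = -1].
Proof.
case: x => [[|[|[|]]] //= lt]; first [constructor 1; exact: val_inj
 | constructor 2; exact: val_inj | constructor 3; exact: val_inj].
Qed.

Lemma F3_double (x : 'F_3) : x + x = - x.
Proof. by case: (F3_cases x) => ->; apply: val_inj. Qed.

Lemma F3_intr_eq0 (z : int) : (z%:~R == 0 :> 'F_3) = (3 %| `|z|)%N.
Proof.
rewrite [z in LHS]intEsign rmorphM rmorph_sign /= mulf_eq0 signr_eq0 /=.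
by rewrite -pmulrn -(dvdn_pcharf (pchar_Fp (isT : prime 3))).
Qed.

Lemma set2_eqP (T : finType) (p q : T * T) :
  [set p.1; p.2] = [set q.1; q.2] -> p = q \/ p = (q.2, q.1).
Proof.
case: p q => [a b] [c d] /= /setP E.
have Ea : a \in [set c; d] by rewrite -E !inE eqxx.
have Eb : b \in [set c; d] by rewrite -E !inE eqxx orbT.
have Ec : c \in [set a; b] by rewrite E !inE eqxx.
have Ed : d \in [set a; b] by rewrite E !inE eqxx orbT.
case/set2P: Ea Ec Ed => ->; case/set2P: Eb => ->; auto.
  by rewrite setUid !inE => _ /eqP ->; left.
by rewrite setUid !inE => /eqP ->; left.
Qed.

(** * Change of orientation, and circulations avoiding forbidden rung values *)

Definition turn (G : mgraph) (o o' : edge G -> vert G * vert G) (e : edge G) : bool :=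
  o' e != o e.

Lemma inc_reorient (R : pzRingType) (G : mgraph) (o o' : edge G -> vert G * vert G) e v :
  orientation o -> orientation o' ->
  inc R o' e v = (-1) ^+ turn o o' e * inc R o e v.
Proof.
move=> o_or o'_or; rewrite /inc /turn; case: (o' e =P o e) => [->|ne] /=.
  by rewrite mul1r.
have [//|->] := set2_eqP (etrans (o'_or e) (esym (o_or e))).
by rewrite mulN1r opprB.
Qed.

Lemma net_reorient (R : comPzRingType) (G : mgraph) o o' (x : edge G -> R) v :
  orientation o -> orientation o' ->
  net o' (fun e => (-1) ^+ turn o o' e * x e) v = net o x v.
Proof.
move=> o_or o'_or; apply: eq_bigr => e _.
by rewrite (inc_reorient _ _ _ o_or o'_or) mulrACA -expr2 sqrr_sign mul1r.
Qed.

(* [D] stands for rungs about to be deleted, so that a single-rung ladder can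
   inherit the property from the two-rung ladder that defines it. *)
Definition avoidable_for (L : Defs.rgraph) (o : edge L -> vert L * vert L) : Prop :=
  forall (D : {set edge L}) (a : edge L -> 'F_3) (e0 : edge L),
    D \subset rungs L -> e0 \in rungs L -> e0 \notin D -> a e0 != 0 ->
  exists x : edge L -> 'F_3,
    [/\ forall v, net o x v = 0,
        forall e, e \in D -> x e = 0,
        forall e, e \notin rungs L -> x e != 0
      & forall e, e \in rungs L -> e \notin D -> x e != a e].

(** Isomorphisms respect only unordered ends, so quantifying over all orientations makes the
    property transportable. *)
Definition avoidable (L : Defs.rgraph) : Prop :=
  forall o, orientation o -> @avoidable_for L o.

(** Reversing an arc negates both its value and its forbidden value, so one orientation decides for
    all. *)
Lemma avoidable_for_any (L : Defs.rgraph) o :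
  orientation o -> @avoidable_for L o -> avoidable L.
Proof.
move=> o_or avL o' o'_or D a e0 sDR e0R e0D ae0.
have [|x [xf x0 xr xa]] := avL D (fun e => (-1) ^+ turn o o' e * a e) e0 sDR e0R e0D.
  by rewrite mulf_neq0 ?signr_eq0.
exists (fun e => (-1) ^+ turn o o' e * x e); split=> [v|e eD|e er|e er eD].
- by rewrite net_reorient.
- by rewrite x0 ?mulr0.
- by rewrite mulf_neq0 ?signr_eq0 ?xr.
- by apply: contraNneq (xa e er eD) => <-; rewrite signrMK.
Qed.

Lemma avoidable_iso (L L' : Defs.rgraph) : isomorphic L L' -> avoidable L -> avoidable L'.
Proof.
case=> f [g [bf bg fg gR]] avL o' o'_or D a e0 sDR e0R e0D ae0.
have [f' fK f'K] := bf; have [g' gK g'K] := bg.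
have gRE e : (g e \in rungs L') = (e \in rungs L).
  by rewrite -gR mem_imset //; apply: can_inj gK.
pose o e := (f' (o' (g e)).1, f' (o' (g e)).2).
have o_or : orientation o.
  move=> e; apply: (imset_inj (can_inj fK)); rewrite fg -o'_or imsetU1 imset_set1.
  by rewrite /= !f'K.
have [||||x [xf x0 xr xa]] := avL o o_or (g @^-1: D) (a \o g) (g' e0).
- by apply/subsetP=> e; rewrite inE => /(subsetP sDR); rewrite gRE.
- by rewrite -gRE g'K.
- by rewrite inE g'K.
- by rewrite /= g'K.
exists (x \o g'); split=> [v|e eD|e er|e er eD] /=.
- rewrite -[RHS](xf (f' v)) /net (reindex g) /=; last exact: onW_bij.
  apply: eq_bigr => e _; rewrite gK /inc /=.
  by rewrite !(can_eq f'K).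
- by rewrite x0 // inE g'K.
- by rewrite xr // -gRE g'K.
- by rewrite -{2}(g'K e); apply: xa; rewrite -?gRE ?inE g'K.
Qed.

(** Values on [D] are forced to be 0 in the larger ladder, so restricting to the remaining edges
    preserves conservation. *)
Lemma avoidable_delete (L : Defs.rgraph) (D : {set edge L}) :
  D \subset rungs L -> avoidable L -> avoidable (delete_rungs D).
Proof.
move=> sDR avL; apply: (avoidable_for_any (@std_orientP _)).
move=> D' a e0 sDR' e0R e0D ae0.
pose a' e := if insub e is Some e' then a e' else 0.
have a'E e : a' (val e) = a e by rewrite /a' valK.
have [||||x [xf x0 xr xa]] :=
    avL _ (@std_orientP L) (D :|: val @: D') a' (val e0).
- apply/subUsetP; split=> //; apply/subsetP=> _ /imsetP[e eD ->].
  by have := subsetP sDR' e eD; rewrite inE.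
- by move: e0R; rewrite inE.
- by rewrite inE (negbTE (valP e0)) mem_imset //; apply: val_inj.
- by rewrite a'E.
exists (x \o val); split=> [v|e eD|e er|e er eD] /=.
- rewrite -[RHS](xf v) /net (@sum_sub _ _ (fun e => e \notin D)) //.
  by move=> e; rewrite negbK => eD; rewrite x0 ?mul0r // inE eD.
- by apply: x0; rewrite inE imset_f ?orbT.
- by apply: xr; move: er; rewrite inE.
- rewrite -a'E; apply: xa; first by move: er; rewrite inE.
  by rewrite inE (negbTE (valP e)) mem_imset //; apply: val_inj.
Qed.

(** Each edge value is repeated along the whole path replacing that edge. *)
Lemma avoidable_subdivide (L : Defs.rgraph) (m : edge L -> nat) :
  (forall e, e \in rungs L -> m e = 0%N) ->
  avoidable L -> avoidable (subdivide_rails m).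
Proof.
move=> m0 avL; apply: (avoidable_for_any (@std_orientP _)).
move=> D a [e0 k0] sDR e0R e0D ae0.
(* Since [m] vanishes on rungs, the first edge over a rung is the only one. *)
pose fst_edge e : edge (subdivide_rails m) :=
  Tagged (fun e => 'I_(m e).+1) (ord0 : 'I_(m e).+1).
have fstE (d : edge (subdivide_rails m)) : tag d \in rungs L -> d = fst_edge (tag d).
  case: d => e k /= /m0 me; congr (existT _ _ _); apply: val_inj => /=.
  by case: k => k /=; rewrite me; case: k.
rewrite inE /= in e0R; have e0E := fstE (existT _ e0 k0) e0R.
rewrite /= in e0E; rewrite e0E in e0D ae0.
have [||||x [xf x0 xr xa]] :=
    avL _ (@std_orientP L) [set e in rungs L | fst_edge e \in D] (a \o fst_edge) e0.
- by apply/subsetP=> e; rewrite inE => /andP[].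
- by [].
- by rewrite inE negb_and e0D orbT.
- by [].
exists (x \o tag); split=> [v|d dD|d dr|d dr dD] /=.
- rewrite /net /=.
  rewrite -(sig_big_dep xpredT (fun _ _ => true)
     (fun e (k : 'I_(m e).+1) => x e *
        (((path_vert m e k) == v)%:R - ((path_vert m e k.+1) == v)%:R))) /=.
  transitivity (\sum_e x e * ((inl (end1 e) == v)%:R - (inl (end2 e) == v)%:R)).
    apply: eq_bigr => e _; rewrite -mulr_sumr; congr (_ * _).
    (* Along one path the incidences telescope to those of its two ends; interior vertices
       cancel. *)
    rewrite -(big_mkord xpredT (fun k => (path_vert m e k == v)%:R - (path_vert m e k.+1 == v)%:R)).
    rewrite (@telescope_sumr_eq _ _ _ (fun k => - (path_vert m e k == v)%:R)) //.
      rewrite /= insubF ?ltnn // opprK addrC //.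
    by move=> k _; rewrite opprK addrC.
  case: v => [v|v]; first exact: (xf v).
  by rewrite big1 // => e _; rewrite subrr mulr0.
- have dr := subsetP sDR d dD; rewrite inE in dr.
  by apply: x0; rewrite inE dr -fstE.
- by apply: xr; move: dr; rewrite inE.
- rewrite inE in dr; rewrite [in a d](fstE d dr); apply: xa => //.
  by rewrite inE dr -fstE.
Qed.

Lemma avoidable_gen_ladder (B : nat -> Defs.rgraph) n L :
  (forall n, (1 < n)%N -> avoidable (B n)) -> gen_ladder B n L -> avoidable L.
Proof.
move=> avB.
have sub k M : (1 < k)%N -> rail_subdivision (B k) M -> avoidable M.
  move=> k1 [m [m0 iso]]; apply: avoidable_iso iso _.
  by apply: avoidable_subdivide => //; apply: avB.
rewrite /gen_ladder; case: ifP => [n1|_]; first exact: sub.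
case=> L2 [D [rs sDR _ iso]]; apply: avoidable_iso iso _.
by apply: avoidable_delete => //; apply: sub rs.
Qed.

(** * Circulations on circular and Möbius ladders *)

Lemma Zp_val_add N (i j : 'Z_N) : i + j = ((i + j) %% (Zp_trunc N).+2)%N :> nat.
Proof. by []. Qed.

Lemma Zp_ltn N (j : 'Z_N) : (1 < N)%N -> (j < N)%N.
Proof. by move=> N1; apply: leq_trans (ltn_ord j) _; rewrite Zp_cast. Qed.

Lemma Zp_val_pred N (j : 'Z_N) : j != 0 -> j = (j - 1)%R.+1 :> nat.
Proof.
move=> j0; have := Zp_val_add (j - 1) 1; rewrite subrK.
have -> : (1 : 'Z_N) = 1%N :> nat by [].
have := ltn_ord (j - 1); move: (j - 1) => k; rewrite addn1 leq_eqVlt.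
case/predU1P=> [->|lt_k]; last by rewrite modn_small.
rewrite modnn => jE; case/eqP: j0; apply: val_inj. by [].
Qed.

Lemma sum_delta (R : pzRingType) (I T : finType) (F : I -> R) (h : I -> T) v w :
  (forall i, (h i == v) = (i == w)) -> \sum_i F i * (h i == v)%:R = F w.
Proof.
move=> hE; rewrite (bigD1 w) //= hE eqxx mulr1 big1 ?addr0 // => i.
by rewrite hE => /negbTE ->; rewrite mulr0.
Qed.

(** The rail value [k] rungs after a start with value [c]. The bit [flip 0] is never read: position
    0 is the rung where the tour starts and closes. *)
Fixpoint spin (c : 'F_3) (flip : nat -> bool) (k : nat) : 'F_3 :=
  if k is k'.+1 then (-1) ^+ flip k * spin c flip k' else c.

Lemma spinS c flip k :
  spin c flip k.+1 = (-1) ^+ flip k.+1 * spin c flip k.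
Proof. by []. Qed.

Lemma spin_cases c flip k : spin c flip k = c \/ spin c flip k = - c.
Proof.
elim: k => [|k [] IH] /=; first by left.
all: by rewrite IH mulr_sign; case: ifP; rewrite ?opprK; auto.
Qed.

(** A kept sign gives rung value 0; a changed one gives [s + s = - s], nonzero with [s]. *)
Lemma F3_sign_diff (b : bool) (s : 'F_3) : s - (-1) ^+ b * s = if b then - s else 0.
Proof. by rewrite mulr_sign; case: b; rewrite ?subrr // opprK F3_double. Qed.

(* Starting from [- a], either sign at the end of the turn avoids [a]. *)
Lemma F3_closing (a s : 'F_3) : a != 0 -> s = - a \/ s = a -> s + a != a.
Proof.
move=> a0 [->|->]; first by rewrite addNr eq_sym.
by rewrite -subr_eq0 addrK.
Qed.

Lemma avoidable_CL n : (1 < n)%N -> avoidable (CL n).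
Proof.
move=> n1; apply: (avoidable_for_any (@std_orientP _)).
move=> D a [p0|i0] sDR e0R e0D ae0; first by rewrite inE in e0R.
(* Deleted rungs keep the sign, hence carry 0. *)
pose fl (i : 'Z_n) := ((inr i : edge (CL n)) \notin D) && (a (inr i) == 0).
(* The start value [- a (inr i0)] is chosen for the closing at [i0]. *)
pose t i := spin (- a (inr i0)) (fun k => fl (i0 + k%:R)) (i - i0)%R.
have tS i : i != i0 -> t i = (-1) ^+ fl i * t (i - 1).
  rewrite -subr_eq0 => /Zp_val_pred E; rewrite /t E spinS -E.
  by rewrite natr_Zp addrC subrK addrAC.
have t_cases i : t i = - a (inr i0) \/ t i = a (inr i0).
  by rewrite -{2}[a _]opprK; apply: spin_cases.
have t0 i : t i != 0 by case: (t_cases i) => ->; rewrite ?oppr_eq0.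
(* Conservation on side [false] dictates the rung value; opposite rail values then balance side
   [true]. *)
pose x (e : edge (CL n)) : 'F_3 :=
  match e with inl (i, j) => (-1) ^+ j * t i | inr i => t (i - 1) - t i end.
exists x; split.
- case=> i j; rewrite /net big_sumType /= /inc /=.
  under eq_bigr do rewrite mulrBr.
  under [X in _ + X]eq_bigr do rewrite mulrBr.
  rewrite !sumrB.
  rewrite (@sum_delta _ _ _ _ _ _ (i, j)) => [|[i' j'] //].
  rewrite (@sum_delta _ _ _ _ _ _ (i - 1, j)) => [|[i' j']]; last first.
    by rewrite /= !xpair_eqE eq_sym -subr_eq eq_sym.
  case: j; rewrite /= ?(expr0, expr1, mul1r, mulN1r).
    rewrite [X in _ + (X - _)]big1 => [|k _]; last by rewrite xpair_eqE andbF mulr0.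
    rewrite (@sum_delta _ _ _ _ _ _ i) => [|k]; last by rewrite xpair_eqE andbT.
    by ring.
  rewrite [X in _ + (_ - X)]big1 => [|k _]; last by rewrite xpair_eqE andbF mulr0.
  rewrite (@sum_delta _ _ _ _ _ _ i) => [|k]; last by rewrite xpair_eqE andbT.
  by ring.
- move=> e eD; have := subsetP sDR e eD; rewrite inE; case: e eD => // i iD _ /=.
  have ne : i != i0 by apply: contraNneq e0D => <-.
  by rewrite (tS i ne) F3_sign_diff /fl iD.
- case=> [[i j]|i]; rewrite inE // => _ /=.
  by rewrite mulf_neq0 ?signr_eq0.
- case=> [p|i]; rewrite inE // => _ iD /=.
  have [->|ne] := eqVneq i i0.
    (* At the seam the value is [t (i0 - 1) + a (inr i0)], and both possible signs of [t (i0 - 1)]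
       avoid [a (inr i0)]. *)
    rewrite {2}/t subrr /= opprK; exact: F3_closing.
  rewrite (tS i ne) F3_sign_diff /fl iD /=.
  by case: (a (inr i) =P 0) => [->|/eqP ai]; rewrite ?oppr_eq0 // eq_sym.
Qed.

Lemma Zp_val_double n (j : 'Z_(n.*2)) : (1 < n)%N ->
  j + n%:R = (if j < n then j + n else j - n)%N :> nat.
Proof.
move=> n1; have N1 : (1 < n.*2)%N by lia.
have lt_j := Zp_ltn j N1.
rewrite Zp_val_add val_Zp_nat // [X in (_ %% X)%N](Zp_cast N1).
rewrite [(n %% _)%N]modn_small; last by lia.
case: ltnP => jn; first by rewrite modn_small //; lia.
have -> : (j + n = (j - n) + n.*2)%N by lia.
by rewrite modnDr modn_small //; lia.
Qed.

(** The rails form one cycle of length [2n] and rungs join antipodes. With antipodal rail values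
    opposite, both ends of a rung balance together, so signs are chosen on half a turn only. *)
Lemma avoidable_Mob n : (1 < n)%N -> avoidable (Mob n).
Proof.
move=> n1; apply: (avoidable_for_any (@std_orientP _)).
move=> D a [p0|k0] sDR e0R e0D ae0; first by rewrite inE in e0R.
have N1 : (1 < n.*2)%N by lia.
pose i0 : 'Z_(n.*2) := (k0 : nat)%:R.
pose fl (k : 'I_n) := ((inr k : edge (Mob n)) \notin D) && (a (inr k) == 0).
(* Position [k] meets the rung of this index. The residue is below [n], so the default [false] never
   occurs. *)
pose flip k := if insub ((k0 + k) %% n)%N is Some r then fl r else false.
pose u := spin (- a (inr k0)) flip.
pose T k := if (k < n)%N then u k else - u (k - n)%N.
pose t (i : 'Z_(n.*2)) := T (i - i0)%R.
have t_anti i : t (i + n%:R) = - t i.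
  rewrite /t addrAC Zp_val_double // /T.
  have lt_j := Zp_ltn (i - i0) N1.
  case: (ltnP (i - i0)%R n) => lt_n; first by rewrite ltnNge leq_addl addnK.
  rewrite opprK ifT //; move: lt_j lt_n; move: (nat_of_ord _) => l; lia.
(* Positions 0 and [n] are excluded: they are the two ends of the seam rung [k0]. *)
have TS k : (0 < k < n.*2)%N -> k != n -> T k = (-1) ^+ flip (k %% n)%N * T k.-1.
  move=> /andP[k0' k2] kn; rewrite /T /u; case: ltnP => lt_kn.
    rewrite modn_small // ifT; last by lia.
    by case: k k0' {k2 kn lt_kn} => // k _; rewrite spinS.
  have -> : (k %% n = k - n)%N.
    by rewrite -[in LHS](subnK lt_kn) modnDr modn_small //; lia.
  rewrite ifF; last by lia.
  have -> : (k - n = (k.-1 - n).+1)%N by lia.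
  by rewrite spinS mulrN.
have t_cases i : t i = - a (inr k0) \/ t i = a (inr k0).
  rewrite /t /T; case: ifP => _.
    by rewrite -{2}[a _]opprK; apply: spin_cases.
  case: (spin_cases (- a (inr k0)) flip ((i - i0)%R - n)%N) => E; rewrite /u E.
    by right; rewrite opprK.
  by left; rewrite opprK.
have t0 i : t i != 0 by case: (t_cases i) => ->; rewrite ?oppr_eq0.
have tS (k : 'I_n) : k != k0 -> t (k : nat)%:R = (-1) ^+ fl k * t ((k : nat)%:R - 1).
  move=> ne; set i : 'Z_(n.*2) := _%:R.
  have lt_j := Zp_ltn (i - i0) N1.
  have kE : ((k0 + (i - i0)%R) %% n = k)%N.
    have : i0 + (i - i0) = i by rewrite addrC subrK.
    move/(congr1 (@nat_of_ord _)); rewrite Zp_val_add.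
    rewrite [X in (_ %% X)%N](Zp_cast N1) !val_Zp_nat //.
    have lt2 (l : 'I_n) : (l < n.*2)%N by have := ltn_ord l; lia.
    rewrite !(modn_small (lt2 _)) => /(congr1 (modn^~ n)).
    by rewrite modn_dvdm ?(modn_small (ltn_ord k)) // -muln2 dvdn_mulr.
  have ne0 : nat_of_ord (i - i0) != 0%N.
    apply: contraNneq ne => E; rewrite -val_eqE /= -kE E addn0.
    by rewrite modn_small.
  have nen : nat_of_ord (i - i0) != n.
    apply: contraNneq ne => E; rewrite -val_eqE /= -kE E modnDr.
    by rewrite modn_small.
  have E : nat_of_ord (i - i0) = (i - 1 - i0)%R.+1.
    by rewrite addrAC; apply: Zp_val_pred; rewrite -val_eqE.
  rewrite /t TS ?lt0n ?ne0 //; congr ((-1) ^+ _ * T _); last by rewrite E.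
  by rewrite /flip modnDmr kE valK.
pose x (e : edge (Mob n)) : 'F_3 :=
  match e with inl i => t i
  | inr k => t ((k : nat)%:R - 1) - t (k : nat)%:R end.
exists x; split.
- move=> v; rewrite /net big_sumType /= /inc /=.
  under eq_bigr do rewrite mulrBr.
  under [X in _ + X]eq_bigr do rewrite mulrBr.
  rewrite !sumrB.
  rewrite (@sum_delta _ _ _ _ _ _ v) => [|i //].
  rewrite (@sum_delta _ _ _ _ _ _ (v - 1)) => [|i]; last by rewrite -subr_eq opprK.
  have natE l : (l < n.*2)%N -> (l%:R == v) = (l == v :> nat).
    by move=> lt_l; rewrite -val_eqE /= val_Zp_nat // modn_small.
  have lt_v := Zp_ltn v N1.
  have lt1 (k : 'I_n) : (k < n.*2)%N by have := ltn_ord k; lia.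
  have lt2 (k : 'I_n) : (k + n < n.*2)%N by have := ltn_ord k; lia.
  (* Either [v] is the tail of rung [v], or it is the head of rung [v - n]. *)
  case: (ltnP v n) => [lt_vn|le_nv].
    rewrite [X in _ + (_ - X)]big1 => [|k _]; last first.
      by rewrite natE // gtn_eqF ?mulr0 // (leq_trans lt_vn) ?leq_addl.
    rewrite (@sum_delta _ _ _ _ _ _ (Ordinal lt_vn)) => [|k]; last by rewrite natE.
    by rewrite /= natr_Zp; ring.
  have lt_vn : (v - n < n)%N by lia.
  rewrite [X in _ + (X - _)]big1 => [|k _]; last first.
    by rewrite natE // ltn_eqF ?mulr0 // (leq_trans (ltn_ord k)).
  rewrite (@sum_delta _ _ _ _ _ _ (Ordinal lt_vn)) => [|k]; last first.
    by rewrite natE // -val_eqE /= -[in RHS](eqn_add2r n) subnK.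
  have vE : (v : 'Z_(n.*2)) = (v - n)%N%:R + n%:R by rewrite -natrD subnK // natr_Zp.
  have tv : t v = - t (v - n)%N%:R by rewrite {1}vE t_anti.
  have tv1 : t (v - 1) = - t ((v - n)%N%:R - 1) by rewrite {1}vE addrAC t_anti.
  by rewrite /= tv tv1; ring.
- move=> e eD; have := subsetP sDR e eD; rewrite inE; case: e eD => // k kD _ /=.
  have ne : k != k0 by apply: contraNneq e0D => <-.
  by rewrite (tS k ne) F3_sign_diff /fl kD.
- by case=> [i|k]; rewrite inE // => _; apply: t0.
- case=> [p|k]; rewrite inE // => _ kD /=.
  have [->|ne] := eqVneq k k0.
    rewrite {2}/t subrr /T (ltnW n1) opprK; exact: F3_closing.
  rewrite (tS k ne) F3_sign_diff /fl kD /=.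
  by case: (a (inr k) =P 0) => [->|/eqP ak]; rewrite ?oppr_eq0 // eq_sym.
Qed.

(** * Lifting flows modulo 3 to integral flows *)

Definition lifts (G : mgraph) (x : edge G -> 'F_3) (phi : edge G -> int) : Prop :=
  forall e, [/\ phi e != 0, `|phi e| < 3 & (phi e)%:~R = x e].

(** Steps along which a lift can move three units of excess from [v] to [w]: a value 1 or 2 on an
    arc towards [w] becomes -2 or -1, and symmetrically for arcs towards [v]. *)
Definition residual (G : mgraph) (phi : edge G -> int) : rel (vert G) :=
  fun v w => [exists e, [&& end1 e == v, end2 e == w & 0 < phi e]
                     || [&& end2 e == v, end1 e == w & phi e < 0]].

Lemma push_edge (G : mgraph) (x : edge G -> 'F_3) phi v w :
  lifts x phi -> residual phi v w ->
  exists phi', [/\ lifts x phi',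
    forall u, net (std_orient G) phi' u =
              net (std_orient G) phi u - (v == u)%:R *+ 3 + (w == u)%:R *+ 3
    & forall e, v \notin ends e -> phi' e = phi e].
Proof.
move=> lx /existsP[e res_e].
pose s : int := if 0 < phi e then 1 else -1.
exists (fun e' => if e' == e then phi e - 3 * s else phi e').
have [phi0 phi3 phix] := lx e.
split=> [e'|u|e' ve'].
- case: (e' =P e) => [->|_]; last exact: lx.
  split; [by rewrite /s; case: ifP; lia | by rewrite /s; case: ifP; lia |].
  rewrite -phix rmorphB rmorphM /=; suff -> : 3%:~R = 0 :> 'F_3 by rewrite mul0r subr0.
  exact: val_inj.
- rewrite /net (bigD1 e) //= eqxx [in RHS](bigD1 e) //=.
  rewrite (eq_bigr (fun e' => phi e' * inc _ (std_orient G) e' u)) => [|e' /negbTE -> //].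
  suff -> : (v == u)%:R = (w == u)%:R + s * inc _ (std_orient G) e u :> int by ring.
  rewrite /inc /s /=; case/orP: res_e => /and3P[/eqP -> /eqP ->]; first by move=> ->; ring.
  by move=> lt0; rewrite ifF; [ring | lia].
- case: eqP => // ee; case/negP: ve'; rewrite ee !inE.
  by case/orP: res_e => /and3P[/eqP -> _ _]; rewrite eqxx ?orbT.
Qed.

(** Inner vertices gain and lose 3. As the path is simple, the first push, which alters only edges
    at [v], leaves its remainder residual. *)
Lemma push_path (G : mgraph) (x : edge G -> 'F_3) p phi v :
  lifts x phi -> path (residual phi) v p -> uniq (v :: p) ->
  exists phi', lifts x phi' /\
    forall u, net (std_orient G) phi' u =
      net (std_orient G) phi u - (v == u)%:R *+ 3 + (last v p == u)%:R *+ 3.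
Proof.
elim: p phi v => [|w p IH] phi v lx /=.
  by move=> _ _; exists phi; split=> // u; rewrite subrK.
case/andP=> res_vw pth; rewrite inE negb_or -andbA => /and4P[vw vp wp up].
have [phi1 [lx1 net1 same1]] := push_edge lx res_vw.
have [|/=|phi2 [lx2 net2]] := IH phi1 w lx1; last 1 first.
- exists phi2; split=> // u; rewrite net2 net1; ring.
- have vwp : v \notin w :: p by rewrite inE negb_or vw.
  elim: p w vwp pth {IH res_vw vw vp wp up net1} => //= y p IH w vwp /andP[rs pth].
  move: vwp; rewrite !inE !negb_or => /and3P[vw vy vp].
  rewrite IH ?inE ?negb_or ?vy // andbT.
  case/existsP: rs => e rs; apply/existsP; exists e; rewrite same1 //.
  rewrite !inE; case/orP: rs => /and3P[/eqP -> /eqP -> _];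
    by rewrite negb_or ?vw ?vy.
- by rewrite wp.
Qed.

(** Cut argument: edges leaving the set reachable from [v] have value at most 0, and entering ones
    at least 0, so the total excess of the set is not positive. As [v] contributes a positive term,
    some member is negative. *)
Lemma residual_sink (G : mgraph) (phi : edge G -> int) v :
  0 < net (std_orient G) phi v ->
  exists2 w, connect (residual phi) v w & net (std_orient G) phi w < 0.
Proof.
move=> v_gt0; pose S := [pred w | connect (residual phi) v w].
have [/existsP[w /andP[Sw w_lt0]]|/existsPn noneg] :=
  boolP [exists w, S w && (net (std_orient G) phi w < 0)]; first by exists w.
have Spos w : S w -> 0 <= net (std_orient G) phi w.
  by move=> Sw; have := noneg w; rewrite Sw /= -leNgt.
have Sv : S v by exact: connect0.
have : 0 < \sum_(w | S w) net (std_orient G) phi w.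
  by rewrite (bigD1 v) //= ltr_wpDr // sumr_ge0 // => w /andP[/Spos].
rewrite ltNge => /negP[]; rewrite /net exchange_big /=.
apply: sumr_le0 => e _; rewrite -mulr_sumr.
have sumS z : \sum_(w | S w) (z == w)%:R = (S z)%:R :> int.
  rewrite big_mkcond (bigD1 z) //= eqxx big1 => [|w]; first by case: ifP.
  by rewrite eq_sym => /negbTE ->; case: ifP.
rewrite /inc sumrB !sumS /=.
have Sstep a b : S a -> residual phi a b -> S b.
  by move=> Sa /connect1; apply: connect_trans.
case S1: (connect _ v (end1 e)); case S2: (connect _ v (end2 e)).
- by rewrite subrr mulr0.
- rewrite subr0 mulr1 leNgt; apply/negP => pos.
  have /Sstep : S (end1 e) by []. move/(_ (end2 e)); rewrite /= S2 => /(_ _)/notF; apply.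
  by apply/existsP; exists e; rewrite !eqxx pos.
- rewrite sub0r mulrN1 oppr_le0 leNgt; apply/negP => neg.
  have /Sstep : S (end2 e) by []. move/(_ (end1 e)); rewrite /= S1 => /(_ _)/notF; apply.
  by apply/existsP; exists e; rewrite !eqxx neg orbT.
- by rewrite subrr mulr0.
Qed.

(* Tutte's modular flow theorem for k = 3. *)
Lemma nowhere_zero_of_F3 (G : mgraph) (x : edge G -> 'F_3) :
  (forall e, x e != 0) -> (forall v, net (std_orient G) x v = 0) ->
  has_nowhere_zero_flow 3 G.
Proof.
move=> x0 xf.
suff [phi [lx phi_f]] : exists phi, lifts x phi /\ forall v, net (std_orient G) phi v = 0.
  exists (std_orient G), phi; split=> [|e]; last by apply/eqP; case: (lx e).
  split=> [//|e|v]; first by case: (lx e).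
  by apply/eqP; rewrite -subr_eq0 -netE phi_f.
have [phi lx] : exists phi, lifts x phi.
  exists (fun e => if x e == 1 then 1 else -1) => e.
  by have := x0 e; case: (F3_cases (x e)) => ->.
(* Induction on the total absolute excess. *)
have [N] := ubnP (\sum_v absz (net (std_orient G) phi v)).
elim: N phi lx => // N IH phi lx.
(* Excesses are multiples of 3 because [phi] reduces to the circulation [x]; hence moving three
   units never overshoots. *)
have dvd3 u : (3 %| absz (net (std_orient G) phi u))%N.
  rewrite -F3_intr_eq0 -[0](xf u) /net rmorph_sum /=; apply/eqP/eq_bigr => e _.
  rewrite rmorphM rmorphB /= !rmorph_nat; by case: (lx e) => _ _ ->.
have [/existsP[v v_gt0]|/existsPn nopos] :=
  boolP [exists v, 0 < net (std_orient G) phi v]; last first.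
  move=> _; exists phi; split=> // v; apply/eqP; rewrite -oppr_eq0; apply/eqP.
  apply: (psumr_eq0P (P := xpredT) (F := fun v => - net (std_orient G) phi v)) => //.
    by move=> u _; rewrite oppr_ge0 leNgt nopos.
  by rewrite sumrN sum_net oppr0.
have [w /connectP[p pth wE] w_lt0] := residual_sink v_gt0.
case/shortenP: pth wE => q qpth uq _ wE.
have [phi' [lx' net']] := push_path lx qpth uq.
rewrite ltnS => leN; apply: IH lx' _; apply: leq_trans leN.
have step u : (absz (net (std_orient G) phi' u) + (v == u) <= absz (net (std_orient G) phi u))%N.
  rewrite net' -wE; have := dvd3 u.
  have [vu|vu] := eqVneq v u; have [wu|wu] := eqVneq w u.
  - by rewrite wu -vu in w_lt0; lia.
  - by rewrite mul0rn addr0 -vu; lia.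
  - by rewrite wu in w_lt0; rewrite mul0rn subr0; lia.
  - by rewrite !mul0rn subr0 addr0 addn0.
rewrite (bigD1 v) //= [leqRHS](bigD1 v) //= -addSn leq_add //.
  by have := step v; rewrite eqxx addn1.
by apply: leq_sum => u _; apply: leq_trans (step u); rewrite leq_addr.
Qed.

(** A boolean form, available because the field is finite, which permits case distinctions on flow
    existence. *)
Definition F3_flowable (G : mgraph) : bool :=
  [exists x : {ffun edge G -> 'F_3},
    [forall e, x e != 0] && [forall v, net (std_orient G) x v == 0]].

Lemma F3_flowableP (G : mgraph) :
  reflect (has_nowhere_zero_flow 3 G) (F3_flowable G).
Proof.
apply: (iffP existsP) => [[x /andP[/forallP x0 /forallP xf]]|].
  by apply: (nowhere_zero_of_F3 x0) => v; apply/eqP.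
case=> o [phi [[o_or phi3 phi_f] phi0]].
pose x e : 'F_3 := (-1) ^+ turn o (std_orient G) e * (phi e)%:~R.
exists [ffun e => x e]; apply/andP; split.
  apply/forallP=> e; rewrite ffunE mulf_neq0 ?signr_eq0 // F3_intr_eq0.
  by have := phi3 e; have := phi0 e; lia.
apply/forallP=> v; rewrite /net; under eq_bigr do rewrite ffunE.
rewrite [X in X == _](net_reorient (fun e => (phi e)%:~R) v o_or (@std_orientP G)).
by rewrite netE -!rmorph_sum phi_f subrr.
Qed.

(** * From a member ladder to the whole graph *)

Lemma extend_circulation (G : mgraph) (S : subgraph G)
    (x : edge (graph_of_sub S) -> 'F_3) :
  (forall v, net (std_orient (graph_of_sub S)) x v = 0) ->
  exists X : edge G -> 'F_3,
    [/\ forall v, net (std_orient G) X v = 0,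
        forall e, e \notin sedges S -> X e = 0
      & forall e, X (val e) = x e].
Proof.
move=> xf; exists (fun e => if insub e is Some e' then x e' else 0).
split=> [v|e eS|e]; [|by rewrite insubN|by rewrite valK].
rewrite /net (@sum_sub _ _ (fun e => e \in sedges S)) => [|e eS]; last first.
  by rewrite insubN ?mul0r.
have [vS|vS] := boolP (v \in sverts S).
  rewrite -[RHS](xf (exist _ v vS)); apply: eq_bigr => e _; rewrite valK /inc /=.
  by rewrite -!val_eqE.
rewrite big1 // => e _; rewrite /inc /=.
have -> : (end1 (val e) == v) = false.
  by apply: contraNF vS => /eqP <-; apply: sub_end1.
have -> : (end2 (val e) == v) = false.
  by apply: contraNF vS => /eqP <-; apply: sub_end2.
by rewrite subrr mulr0.
Qed.

(** For [a = - x], adding such an [X] to [x] leaves no zero on [S] and changes nothing elsewhere. *)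
Definition avoids (G : mgraph) (S : subgraph G) (a : edge G -> 'F_3) : Prop :=
  exists X : edge G -> 'F_3,
    [/\ forall v, net (std_orient G) X v = 0,
        forall e, e \notin sedges S -> X e = 0
      & forall e, e \in sedges S -> X e != a e].

(** An edge with nonzero forbidden value must be a rung, so the ladder construction applies with
    nothing deleted. If there is none, [a] is zero on [S] and a nowhere-zero flow serves. *)
Lemma ladder_avoids (G : mgraph) (S : subgraph G) (R : {set edge G})
    (a : edge G -> 'F_3) :
  is_closed_ladder_with S R ->
  (forall e, e \in sedges S -> e \notin R -> a e = 0) ->
  F3_flowable (graph_of_sub S) || [exists e in sedges S, a e != 0] ->
  avoids S a.
Proof.
case=> sRS [n lad] a0 ok.
suff [x [xf xa]] : exists x : edge (graph_of_sub S) -> 'F_3,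
    (forall v, net (std_orient (graph_of_sub S)) x v = 0) /\
    (forall e, x e != a (val e)).
  have [X [Xf X0 XE]] := extend_circulation xf.
  by exists X; split=> // e eS; rewrite -[e]/(val (exist _ e eS)) XE.
have [/exists_inP[e0 e0S ae0]|none] := boolP [exists e in sedges S, a e != 0].
  have e0R : e0 \in R by apply: contraNT ae0 => /(a0 _ e0S) ->.
  have av : avoidable (@RGraph (graph_of_sub S) [set e | val e \in R]).
    case: lad; apply: avoidable_gen_ladder => k; first exact: avoidable_CL.
    exact: avoidable_Mob.
  have [||||x [xf _ xr xa]] := av _ (@std_orientP _) set0 (a \o val) (exist _ e0 e0S).
  - exact: sub0set.
  - by rewrite inE.
  - by rewrite inE.
  - by [].
  exists x; split=> // e; have [eR|eR] := boolP (val e \in R).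
    by apply: xa; rewrite ?inE.
  by rewrite (a0 _ (valP e) eR); apply: xr; rewrite inE.
move: ok; rewrite (negbTE none) orbF => /existsP[x /andP[/forallP x0 /forallP xf]].
exists x; split=> [v|e]; first exact/eqP.
have -> : a (val e) = 0.
  by apply/eqP; apply: contraNT none => ae; apply/exists_inP; exists (val e); rewrite ?(valP e).
exact: x0.
Qed.

(** * Treating the members of the family one at a time *)

Definition touched (G : mgraph) (P : {set subgraph G}) (e : edge G) : bool :=
  [exists S in P, e \in sedges S].

Lemma touchedU1 (G : mgraph) (S : subgraph G) (P : {set subgraph G}) e :
  touched (S |: P) e = (e \in sedges S) || touched P e.
Proof.
apply/exists_inP/orP => [[S' /setU1P[->|SP] eS']|[eS|/exists_inP[S' SP eS']]].
- by left.
- by right; apply/exists_inP; exists S'.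
- by exists S; rewrite ?setU11.
- by exists S'; rewrite ?setU1r.
Qed.

(* The sum of circulations on the members of [P] treated so far: it vanishes on
   at most one touched edge, which can still be repaired by a later member. *)
Definition partial_flow (G : mgraph) (F P : {set subgraph G})
    (x : edge G -> 'F_3) : Prop :=
  [/\ forall v, net (std_orient G) x v = 0,
      forall e, ~~ touched P e -> x e = 0,
      forall e, touched P e -> x e = 0 ->
        exists2 S, S \in F :\: P & e \in sedges S
    & forall e e', touched P e -> touched P e' -> x e = 0 -> x e' = 0 -> e = e'].

Lemma partial_flow_step (G : mgraph) (F P : {set subgraph G}) (E : {set edge G})
    (x : edge G -> 'F_3) :
  (forall e S S', S \in F -> S' \in F -> e \in sedges S -> e \in sedges S' ->
     S != S' -> e \in E) ->
  (forall e S, e \in E -> exists S', [/\ S' \in F, e \in sedges S' & S' != S]) ->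
  (forall S, S \in F -> ~~ F3_flowable (graph_of_sub S) ->
     (2 <= #|sedges S :&: E|)%N) ->
  (forall S a, S \in F -> (forall e, e \in sedges S -> e \notin E -> a e = 0) ->
     F3_flowable (graph_of_sub S) || [exists e in sedges S, a e != 0] ->
     avoids S a) ->
  P \proper F -> partial_flow F P x ->
  exists (S : subgraph G) (x' : edge G -> 'F_3),
    S \in F :\: P /\ partial_flow F (S |: P) x'.
Proof.
move=> sharedE other ge2E avoid /properP[sPF [S0 S0F S0P]] [xf x0 xz xu].
have net_add (y : edge G -> 'F_3) : (forall v, net (std_orient G) y v = 0) ->
    forall v, net (std_orient G) (x \+ y) v = 0.
  move=> yf v; rewrite /net; under eq_bigr do rewrite mulrDl.
  by rewrite big_split /= -!/(net _ _ _) xf yf addr0.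
(* An edge outside [E] lies in one member only, so it is untouched while that member is
   untreated. *)
have offE S e : S \in F :\: P -> e \in sedges S -> e \notin E -> x e = 0.
  move=> /setDP[SF SP] eS eE; apply: x0; apply: contra eE.
  case/exists_inP=> S' SP' eS'; apply: (sharedE e S S') => //; first exact: (subsetP sPF).
  by apply: contraNneq SP => ->.
have [/exists_inP[S SFP ok]|bad] := boolP [exists S in F :\: P,
    F3_flowable (graph_of_sub S) || [exists e in sedges S, x e != 0]].
  have [SF SP] := setDP SFP.
  have [||y [yf y0 ya]] := avoid S (fun e => - x e) SF.
  - by move=> e eS /(offE _ _ SFP eS) ->; rewrite oppr0.
  - case/orP: ok => [->//|/exists_inP[e eS xe]]; apply/orP; right.
    by apply/exists_inP; exists e; rewrite ?oppr_eq0.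
  exists S, (x \+ y); split=> //.
  (* Remaining zeros avoid [S], hence are old defects. *)
  have zero e : touched (S |: P) e -> x e + y e = 0 ->
      [/\ e \notin sedges S, touched P e & x e = 0].
    rewrite touchedU1; have [eS _|eS /= eP] := boolP (e \in sedges S).
      by move/eqP; rewrite addrC addr_eq0 (negbTE (ya e eS)).
    by rewrite (y0 e eS) addr0.
  split=> [|e|e|e e'] /=.
  + exact: net_add.
  + by rewrite touchedU1 negb_or => /andP[eS eP]; rewrite x0 // y0 // addr0.
  + move=> eT /(zero e eT)[eS eP xe]; have [S' SF' eS'] := xz e eP xe.
    exists S' => //; rewrite !inE negb_or in SF' *; case/andP: SF' => -> ->.
    by rewrite !andbT; apply: contraNneq eS => <-.
  + move=> eT eT' /(zero e eT)[_ eP xe] /(zero e' eT')[_ eP' xe'].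
    exact: xu.
(* From here on no untreated member is flowable or meets a nonzero value. *)
have allzero S e : S \in F :\: P -> e \in sedges S -> x e = 0.
  move=> SFP eS; apply/eqP; apply: contraNT bad => xe.
  by apply/exists_inP; exists S => //; apply/orP; right; apply/exists_inP; exists e.
have ge2 S : S \in F :\: P -> (2 <= #|sedges S :&: E|)%N.
  move=> SFP; have [SF _] := setDP SFP; apply: ge2E => //; apply/negP => fl.
  by case/negP: bad; apply/exists_inP; exists S => //; rewrite fl.
(* [S] passes through the defect if there is one, and [e1] is an edge of [S] in [E] to which the
   defect may move. *)
have [S [e1 [SFP e1S e1E cov]]] : exists (S : subgraph G) e1,
    [/\ S \in F :\: P, e1 \in sedges S, e1 \in E
      & forall e, touched P e -> x e = 0 -> e \in sedges S /\ e != e1].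
  have [/existsP[e2 /andP[e2P /eqP xe2]]|none] :=
    boolP [exists e, touched P e && (x e == 0)].
    have [S SFP e2S] := xz e2 e2P xe2; exists S.
    have := ge2 S SFP; rewrite (cardsD1 e2) => card2.
    have /card_gt0P[e1] : (0 < #|(sedges S :&: E) :\ e2|)%N.
      by case: (_ \in _) card2 => //; apply: ltnW.
    case/setD1P=> ne /setIP[e1S e1E]; exists e1; split=> // e eP xe.
    by rewrite (xu e e2) //; split=> //; rewrite eq_sym.
  have S0FP : S0 \in F :\: P by rewrite inE S0P.
  have /card_gt0P[e1] : (0 < #|sedges S0 :&: E|)%N by apply: ltnW (ge2 S0 S0FP).
  case/setIP=> e1S e1E; exists S0, e1; split=> // e eP xe.
  by case/existsP: none; exists e; rewrite eP xe eqxx.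
have [SF SP] := setDP SFP.
(* Forbidding 1 at [e1] and 0 elsewhere makes [y] nonzero on [S] except perhaps at [e1]; the nonzero
   entry at [e1] is what allows the ladder construction. *)
have [||y [yf y0 ya]] := avoid S (fun e => (e == e1)%:R) SF.
- by move=> e eS eE; case: eqP eE => // ->; rewrite e1E.
- by apply/orP; right; apply/exists_inP; exists e1; rewrite ?eqxx ?oner_eq0.
exists S, (x \+ y); split=> //.
have zero e : touched (S |: P) e -> x e + y e = 0 -> e = e1.
  rewrite touchedU1; have [eS _|eS /= eP] := boolP (e \in sedges S).
    rewrite (allzero S) // add0r => ye; have := ya e eS; rewrite ye.
    by case: (e =P e1) => //; rewrite eqxx.
  by rewrite (y0 e eS) addr0 => /(cov e eP)[]; rewrite (negbTE eS).
split=> [|e|e|e e'] /=.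
+ exact: net_add.
+ by rewrite touchedU1 negb_or => /andP[eS eP]; rewrite x0 // y0 // addr0.
+ move=> eT /(zero e eT) ->; have [S' [SF' eS' ne]] := other e1 S e1E.
  exists S' => //; rewrite !inE SF' (negbTE ne) /= andbT; apply/negP => SP'.
  (* Were [S'] already treated, [e1] would be an old defect, contrary to its choice. *)
  have e1P : touched P e1 by apply/exists_inP; exists S'.
  by have [_] := cov e1 e1P (allzero S e1 SFP e1S); rewrite eqxx.
+ by move=> eT eT' /(zero e eT) -> /(zero e' eT') ->.
Qed.

Local Close Scope ring_scope.

Theorem theorem3p4 (G : mgraph) (F : {set subgraph G}) (E : {set edge G})
  (rungs_of : subgraph G -> {set edge G})
  (union_verts : \bigcup_(S in F) sverts S = [set: vert G])
  (union_edges : \bigcup_(S in F) sedges S = [set: edge G])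
  (F_ladder : forall S, S \in F -> is_closed_ladder_with S (rungs_of S))
  (E_rung : forall S, S \in F -> sedges S :&: E \subset rungs_of S)
  (E_ge2 : forall S, S \in F ->
     ~ has_nowhere_zero_flow 3 (graph_of_sub S) -> 2 <= #|sedges S :&: E|)
  (E_shared : forall e, e \in E -> 2 <= #|[set S in F | e \in rungs_of S]|)
  (nE_unique : forall e, e \notin E ->
     exists! S, S \in F /\ e \in sedges S) :
  has_nowhere_zero_flow 3 G.
Proof.
have sharedE e S S' : S \in F -> S' \in F -> e \in sedges S -> e \in sedges S' ->
    S != S' -> e \in E.
  move=> SF SF' eS eS'; apply: contraNT => /nE_unique[T [_ uT]].
  by rewrite -(uT S) // -(uT S').
have other e S : e \in E -> exists S', [/\ S' \in F, e \in sedges S' & S' != S].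
  move=> /E_shared; rewrite (cardsD1 S) => card2.
  have /card_gt0P[S'] : 0 < #|[set S in F | e \in rungs_of S] :\ S|.
    by case: (_ \in _) card2 => //; apply: ltnW.
  rewrite !inE => /and3P[ne SF' eR]; exists S'; split=> //.
  by have [/subsetP/(_ e eR)] := F_ladder S' SF'.
have ge2E S : S \in F -> ~~ F3_flowable (graph_of_sub S) -> 2 <= #|sedges S :&: E|.
  by move=> SF /F3_flowableP; apply: E_ge2.
have avoid S a : S \in F -> (forall e, e \in sedges S -> e \notin E -> a e = 0%R) ->
    F3_flowable (graph_of_sub S) || [exists e in sedges S, a e != 0%R] -> avoids S a.
  move=> SF a0; apply: ladder_avoids (F_ladder S SF) _ => e eS eR; apply: a0 => //.
  apply: contra eR => eE; apply: (subsetP (E_rung S SF)); by rewrite inE eS.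
have [x [xf _ xz _]] : exists x, partial_flow F F x.
  (* Induction on the number of untreated members, from the zero circulation with nothing
     treated. *)
  suff run N P x : #|F :\: P| < N -> P \subset F -> partial_flow F P x -> exists x, partial_flow F F x.
    apply: (run _ set0 (fun=> 0%R) (ltnSn _)); first exact: sub0set.
    have t0 e : touched (@set0 (subgraph G)) e = false by apply/exists_inP => -[S]; rewrite inE.
    split=> [v|//|e|e e']; rewrite ?t0 //.
    by rewrite /net big1 // => e _; rewrite mul0r.
  elim: N P x => // N IH P x ltN sPF invP.
  have [PF|neq] := eqVneq P F; first by rewrite PF in invP; exists x.
  have [|S [x' [SFP invS]]] :=
    partial_flow_step sharedE other ge2E avoid _ invP; first by rewrite properEneq neq.
  apply: IH invS; last by rewrite subUset sub1set; case/setDP: SFP => -> _.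
  by move: ltN; rewrite (cardsD1 S) SFP setDDl setUC.
apply: (nowhere_zero_of_F3 _ xf) => e; apply/eqP => xe.
have /bigcupP[S SF eS] : e \in \bigcup_(S in F) sedges S by rewrite union_edges inE.
(* A zero would require an untreated member, and none is left. *)
have [|S'] := xz e _ xe; last by rewrite setDv inE.
by apply/exists_inP; exists S.
Qed.
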